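(* Let $r\ge1$ and $d\ge1$. The number of $r$-tuples $(g_1,\dots,g_r)$ of permutations in the symmetric group $S_d$, counted up to simultaneous conjugation by $S_d$, that generate a transitive subgroup of $S_d$ equals $$\frac1d\sum_{m\mid d}m\,\mu(d/m)\sum_{\substack{n_1,\dots,n_m\ge0\\ \sum_kkn_k=m}}(-1)^{\ell-1}\frac{(\ell-1)!}{n_1!\cdots n_m!}\prod_{k=1}^m\Big(\sum_{\kappa\vdash k}z_\kappa^{\,r-1}\Big)^{n_k},\qquad\ell=\textstyle\sum_kn_k,$$ where for a partition $\kappa=(1^{m_1}2^{m_2}\cdots k^{m_k})$ of $k$, $z_\kappa=\prod_{j}j^{m_j}m_j!$.
   Context: $\mu$ is the classical Möbius function; $\kappa\vdash k$ means $\kappa$ ranges over partitions of $k$; $z_\kappa$ is the order of the centralizer in $S_k$ of a permutation of cycle type $\kappa$. *)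

(* Defs.v *)
From mathcomp Require Import all_boot all_order all_algebra all_fingroup.
Set Implicit Arguments. Unset Strict Implicit. Unset Printing Implicit Defensive.
Import GRing.Theory Num.Theory.
Local Open Scope ring_scope.

Definition moebius (n : nat) : int :=
  if all (fun p => logn p n == 1)%N (primes n) then (-1) ^+ size (primes n) else 0.

(* A partition kappa of k, given by its multiplicity vector:
   m j = number of parts equal to j.+1, subject to sum_j (j+1) m_j = k. *)
Definition is_partition (k : nat) (m : {ffun 'I_k -> 'I_k.+1}) : bool :=
  (\sum_(j < k) j.+1 * m j)%N == k.

(* z_kappa = prod_j (j)^{m_j} m_j! (order of the centralizer). *)
Definition zk (k : nat) (m : {ffun 'I_k -> 'I_k.+1}) : nat :=
  (\prod_(j < k) (j.+1 ^ m j * (m j)`!))%N.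

Definition Zsum (r k : nat) : rat :=
  \sum_(m : {ffun 'I_k -> 'I_k.+1} | is_partition m) ((zk m)%:R) ^+ r.-1.

(* inner sum over (n_1,...,n_m) with sum_k k n_k = m; index k is stored as k.+1 *)
Definition inner_sum (r m : nat) : rat :=
  \sum_(n : {ffun 'I_m -> 'I_m.+1} | is_partition n)
    let l := (\sum_(k < m) n k)%N in
    (-1) ^+ l.-1 * (l.-1)`!%:R / (\prod_(k < m) (n k)`!)%:R
    * \prod_(k < m) (Zsum r k.+1) ^+ (n k).

Definition formula (r d : nat) : rat :=
  d%:R^-1 * \sum_(m <- divisors d) m%:R * (moebius (d %/ m))%:~R * inner_sum r m.

Definition tuples (r d : nat) := {ffun 'I_r -> 'S_d}.

Definition transitive_tuple r d (t : tuples r d) : bool :=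
  [transitive <<[set t i | i : 'I_r]>>, on [set: 'I_d] | 'P].

Definition conj_tuple r d (t : tuples r d) (h : 'S_d) : tuples r d :=
  [ffun i => (t i ^ h)%g].

Definition conj_orbit r d (t : tuples r d) : {set tuples r d} :=
  [set conj_tuple t h | h : 'S_d].

Definition num_transitive_classes (r d : nat) : nat :=
  #|[set conj_orbit t | t in [set t : tuples r d | transitive_tuple t]]|.

(* Main.v *)
(* An r-tuple of permutations of X is an action of the free group F_r on X, and
   simultaneous conjugacy is isomorphism. Let a_k be the number of isomorphism
   classes of actions on k points and c_d the number of transitive ones.

   An action splits off a copy of the transitive action c iff c embeds into it,
   and c + v ~ c + v' implies v ~ v'. Hence, weighting each class t of size k by
   its number |Emb(c,t)| / |Aut c| of orbits of type c, the weights sum to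
   sum_(j >= 1) a_(k - j d). Summing d times this over all transitive c counts
   every point of every class once, so
     k a_k = sum_(1 <= m <= k) (sum_(d | m) d c_d) a_(k - m).
   This is the recursion satisfied by m times the m-th coefficient of
   log (sum_k a_k x^k), and Moebius inversion isolates d c_d.

   Finally a_k = sum_kappa z_kappa^(r-1) by Burnside's lemma; that z_kappa is a
   centralizer order, and that cycle types classify permutations, come from the
   same splitting and cancellation applied to actions of F_1 = Z. *)
Require Import Defs.
From mathcomp Require Import all_boot all_order all_algebra all_fingroup.
Set Implicit Arguments. Unset Strict Implicit. Unset Printing Implicit Defensive.
Import GRing.Theory Num.Theory.
Local Open Scope nat_scope.

(** * Actions of a free group on finite sets *)

Section Systems.

Variable r : nat.

Definition psys (X : finType) := {ffun 'I_r -> {perm X}}.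

Implicit Types X Y Z U V W : finType.

Definition Emb X Y (t : psys X) (s : psys Y) : {set {ffun X -> Y}} :=
  [set f : {ffun X -> Y} |
    injectiveb f && [forall i, forall x, f (t i x) == s i (f x)]].

Lemma EmbP X Y (t : psys X) (s : psys Y) (f : {ffun X -> Y}) :
  reflect (injective f /\ forall i x, f (t i x) = s i (f x)) (f \in Emb t s).
Proof.
rewrite inE; apply: (iffP andP) => -[].
  by move=> /injectiveP fI /forallP fE; split=> // i x; exact/eqP/(forallP (fE i)).
move=> fI fE; split; first exact/injectiveP.
by apply/forallP => i; apply/forallP => x; rewrite fE.
Qed.

Lemma mem_Emb X Y (t : psys X) (s : psys Y) (f : X -> Y) :
  injective f -> (forall i x, f (t i x) = s i (f x)) -> finfun f \in Emb t s.
Proof.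
by move=> fI fE; apply/EmbP; split=> [x y|i x]; rewrite !ffunE //; apply: fI.
Qed.

Definition comp_ffun X Y Z (g : {ffun Y -> Z}) (f : {ffun X -> Y}) :=
  [ffun x => g (f x)].

Lemma Emb_comp X Y Z (t : psys X) (s : psys Y) (w : psys Z) f g :
  f \in Emb t s -> g \in Emb s w -> comp_ffun g f \in Emb t w.
Proof.
case/EmbP=> fI fE /EmbP[gI gE]; apply: mem_Emb => [x y /gI /fI //|i x].
by rewrite fE gE.
Qed.

Lemma comp_ffun_injr X Y Z (g : {ffun Y -> Z}) :
  injective g -> injective (@comp_ffun X Y Z g).
Proof.
move=> gI f f' /ffunP eq_gf; apply/ffunP => x; apply: gI.
by have := eq_gf x; rewrite !ffunE.
Qed.

(** Between finite sets of equal size an injective equivariant map is bijective, so no inverse has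
    to be carried along. *)
Definition iso X Y (t : psys X) (s : psys Y) : bool :=
  (#|X| == #|Y|) && (Emb t s != set0).

Lemma isoP X Y (t : psys X) (s : psys Y) :
  reflect (#|X| = #|Y| /\ exists f, f \in Emb t s) (iso t s).
Proof.
by apply: (iffP andP) => -[/eqP cXY /set0Pn].
Qed.

Lemma iso_card X Y (t : psys X) (s : psys Y) : iso t s -> #|X| = #|Y|.
Proof. by case/isoP. Qed.

Lemma iso_refl X (t : psys X) : iso t t.
Proof. by apply/isoP; split=> //; exists (finfun id); apply: mem_Emb. Qed.

Lemma Emb_iso X Y (t : psys X) (s : psys Y) f :
  #|X| = #|Y| -> f \in Emb t s -> iso t s.
Proof. by move=> cXY fE; apply/isoP; split=> //; exists f. Qed.

Lemma iso_sym X Y (t : psys X) (s : psys Y) : iso t s -> iso s t.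
Proof.
case/isoP=> cXY [f /EmbP[fI fE]].
have /inj_card_bij[|g fK gK] := fI; first by rewrite cXY.
apply: (@Emb_iso _ _ _ _ (finfun g)) => //; apply: mem_Emb => [|i y].
  exact: can_inj gK.
by apply: fI; rewrite gK fE gK.
Qed.

Lemma iso_trans X Y Z (t : psys X) (s : psys Y) (w : psys Z) :
  iso t s -> iso s w -> iso t w.
Proof.
case/isoP=> cXY [f fE] /isoP[cYZ [g gE]].
by apply: Emb_iso (Emb_comp fE gE); rewrite cXY.
Qed.

Lemma leq_card_Emb X Y Z (c : psys X) (t : psys Y) (s : psys Z) :
  iso t s -> #|Emb c t| <= #|Emb c s|.
Proof.
case/isoP=> cYZ [g gE]; have /EmbP[gI _] := gE.
rewrite -(card_imset _ (@comp_ffun_injr X _ _ g gI)).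
by apply/subset_leq_card/subsetP => _ /imsetP[f fE ->]; apply: Emb_comp gE.
Qed.

Lemma card_Emb_iso X Y Z (c : psys X) (t : psys Y) (s : psys Z) :
  iso t s -> #|Emb c t| = #|Emb c s|.
Proof.
by move=> ts; apply/eqP; rewrite eqn_leq !leq_card_Emb // iso_sym.
Qed.

Lemma card_Emb_isol X Y Z (c : psys X) (t : psys Y) (s : psys Z) :
  iso t s -> #|Emb t c| = #|Emb s c|.
Proof.
suff le A B (a : psys A) (b : psys B) : iso a b -> #|Emb b c| <= #|Emb a c|.
  by move=> ts; apply/eqP; rewrite eqn_leq !le // iso_sym.
case/isoP=> cAB [g gE]; have /EmbP[gI _] := gE.
have /inj_card_bij[|h gK hK] := gI; first by rewrite cAB.
have cI : injective (fun f : {ffun B -> X} => comp_ffun f g).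
  move=> f f' /ffunP eq_gf; apply/ffunP => y.
  by have := eq_gf (h y); rewrite !ffunE hK.
rewrite -(card_imset _ cI).
by apply/subset_leq_card/subsetP => _ /imsetP[f fE ->]; apply: Emb_comp fE.
Qed.

(** * Invariant subsets, transitivity and disjoint sums *)

Definition invariant_set X (t : psys X) (A : {set X}) :=
  [forall i, forall x in A, t i x \in A].

Lemma invariant_setP X (t : psys X) (A : {set X}) :
  reflect (forall i x, x \in A -> t i x \in A) (invariant_set t A).
Proof.
apply: (iffP forallP) => [tA i x|tA i]; first exact: (forall_inP (tA i)).
by apply/forall_inP => x; apply: tA.
Qed.

(** By finiteness each [t i] permutes an invariant set; complements of invariant sets are therefore
    invariant. *)
Lemma invariant_setE X (t : psys X) (A : {set X}) i x :
  invariant_set t A -> (t i x \in A) = (x \in A).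
Proof.
move/invariant_setP=> tA.
have : t i @: A = A.
  apply/eqP; rewrite eqEcard card_imset ?leqnn ?andbT; last exact: perm_inj.
  by apply/subsetP => _ /imsetP[y yA ->]; apply: tA.
by move=> {1}<-; rewrite mem_imset //; apply: perm_inj.
Qed.

(** Phrased by invariant sets instead of a generated group; [transitive_tupleE] gives the link to
    [transitive_tuple]. *)
Definition transitive_psys X (t : psys X) :=
  (0 < #|X|) && [forall A : {set X}, invariant_set t A ==>
                   (A == set0) || (A == setT)].

Lemma transitive_psysP X (t : psys X) (A : {set X}) x :
  transitive_psys t -> (forall i y, y \in A -> t i y \in A) -> x \in A ->
  A = setT.
Proof.
case/andP=> _ /forallP/(_ A)/implyP tA /invariant_setP/tA.
by case/orP=> /eqP-> //; rewrite inE.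
Qed.

Lemma transitive_psys_pick X (t : psys X) : transitive_psys t -> exists x : X, true.
Proof. by case/andP=> /card_gt0P[x _] _; exists x. Qed.

Lemma iso_transitive X Y (t : psys X) (s : psys Y) :
  iso t s -> transitive_psys t -> transitive_psys s.
Proof.
case/isoP=> cXY [f /EmbP[fI fE]] tt; apply/andP; split.
  by rewrite -cXY; case/andP: tt.
have /inj_card_bij[|g fK gK] := fI; first by rewrite cXY.
apply/forallP => A; apply/implyP => /invariant_setP sA.
have [->|[y yA]] := set_0Vmem A; rewrite ?eqxx //; apply/orP; right.
have /setP A'E : [set x | f x \in A] = setT.
  apply: (transitive_psysP (x := g y) tt); last by rewrite inE gK.
  by move=> i x; rewrite !inE fE; apply: sA.
by apply/eqP/setP => z; have := A'E (g z); rewrite !inE gK.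
Qed.

Definition sum_fun X Y (f : X -> X) (g : Y -> Y) (z : X + Y) : X + Y :=
  match z with inl x => inl (f x) | inr y => inr (g y) end.

Lemma sum_fun_inj X Y (f : {perm X}) (g : {perm Y}) : injective (sum_fun f g).
Proof. by move=> [x|y] [x'|y'] //= [] /perm_inj ->. Qed.

Definition psum X Y (t : psys X) (s : psys Y) : psys (X + Y)%type :=
  [ffun i => perm (@sum_fun_inj X Y (t i) (s i))].

Lemma psumE X Y (t : psys X) (s : psys Y) i z :
  psum t s i z = sum_fun (t i) (s i) z.
Proof. by rewrite ffunE permE. Qed.

Lemma sub_perm_inj X (A : {set X}) (p : {perm X})
    (pA : forall x, x \in A -> p x \in A) :
  injective (fun x : {x | x \in A} =>
    exist (fun x => x \in A) (p (val x)) (pA _ (valP x))).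
Proof. by move=> x y /(congr1 val) /= /perm_inj /val_inj. Qed.

Lemma restrict_psys X (t : psys X) (A : {set X}) :
  invariant_set t A ->
  exists s : psys {x | x \in A}, forall i x, val (s i x) = t i (val x).
Proof.
move/invariant_setP=> tA.
exists [ffun i => perm (@sub_perm_inj X A (t i) (tA i))] => i x.
by rewrite ffunE permE.
Qed.

(** The complement of the image of [f] is invariant and carries [v]. That [g] extends [f] lets
    [card_Aut_psum] extend embeddings to automorphisms. *)
Lemma split_psys X Y (u : psys X) (t : psys Y) f :
  f \in Emb u t ->
  exists Z (v : psys Z) (g : {ffun X + Z -> Y}),
    [/\ #|Y| = #|X| + #|Z|, g \in Emb (psum u v) t & forall x, g (inl x) = f x].
Proof.
case/EmbP=> fI fE; pose A := ~: [set f x | x in X].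
have tA : invariant_set t A.
  have tA' : invariant_set t [set f x | x in X].
    apply/invariant_setP => i _ /imsetP[x _ ->]; rewrite -fE.
    exact: imset_f.
  by apply/invariant_setP => i x; rewrite !inE invariant_setE.
have [v vE] := restrict_psys tA.
pose g (z : X + {x | x \in A}) : Y := match z with inl x => f x | inr y => val y end.
exists {x | x \in A}, v, (finfun g); split; last by move=> x; rewrite ffunE.
  have -> : #|{: {x | x \in A}}| = #|A| by rewrite card_sig.
  by rewrite -(cardsC [set f x | x in X]) card_imset.
apply: mem_Emb => [|i [x|y]].
- have nfA x y : x \in A -> f y <> x.
    by move=> + fyx; rewrite -fyx inE imset_f.
  move=> [x|y] [x'|y'] /=; first by move/fI->.
  + by move/nfA=> []; apply: valP.
  + by move/esym/nfA=> []; apply: valP.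
  + by move/val_inj->.
- by rewrite psumE /= fE.
by rewrite psumE /= vE.
Qed.

(** A nonempty invariant set of least size is transitive: a nonempty invariant part of it is
    invariant in [X] too, hence not smaller. *)
Lemma transitive_sub X (t : psys X) :
  0 < #|X| -> exists Y (u : psys Y) f, transitive_psys u /\ f \in Emb u t.
Proof.
move=> X_gt0; pose P A := (A != set0) && invariant_set t A.
have PT : P setT.
  rewrite /P -card_gt0 cardsT X_gt0; apply/invariant_setP => i x.
  by rewrite !inE.
case: (arg_minnP (fun A : {set X} => #|A|) PT) => A /andP[A0 tA] minA.
have [u uE] := restrict_psys tA.
exists {x | x \in A}, u, (finfun val); split; last exact: mem_Emb (@val_inj _ _ _) uE.
apply/andP; split; first by rewrite card_sig card_gt0.
apply/forallP => B; apply/implyP => /invariant_setP uB.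
rewrite -implyNb; apply/implyP => B0.
suff /minA : P (val @: B).
  rewrite card_imset => [leAB|]; last exact: val_inj.
  by rewrite eqEcard subsetT cardsT card_sig.
apply/andP; split.
  by case/set0Pn: B0 => x xB; apply/set0Pn; exists (val x); apply: imset_f.
apply/invariant_setP => i _ /imsetP[x xB ->]; rewrite -uE.
by apply/imset_f/uB.
Qed.

Definition sum_ffun X X' Y Y' (f : {ffun X -> X'}) (g : {ffun Y -> Y'}) :
    {ffun X + Y -> X' + Y'} :=
  [ffun z => match z with inl x => inl (f x) | inr y => inr (g y) end].

Lemma Emb_sum X X' Y Y' (u : psys X) (u' : psys X') (v : psys Y) (v' : psys Y') f g :
  f \in Emb u u' -> g \in Emb v v' ->
  sum_ffun f g \in Emb (psum u v) (psum u' v').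
Proof.
case/EmbP=> fI fE /EmbP[gI gE]; apply: mem_Emb => [|i [x|y]].
- by move=> [x|y] [x'|y'] //= [] => [/fI|/gI] ->.
- by rewrite !psumE /= fE.
- by rewrite !psumE /= gE.
Qed.

Lemma psum_iso X X' Y Y' (u : psys X) (u' : psys X') (v : psys Y) (v' : psys Y') :
  iso u u' -> iso v v' -> iso (psum u v) (psum u' v').
Proof.
case/isoP=> cX [f fE] /isoP[cY [g gE]].
by apply: Emb_iso (Emb_sum fE gE); rewrite !card_sum cX cY.
Qed.

Lemma inl_Emb X Y (u : psys X) (v : psys Y) : finfun inl \in Emb u (psum u v).
Proof. by apply: mem_Emb => [? ? []|i x] //; rewrite psumE. Qed.

Lemma inr_Emb X Y (u : psys X) (v : psys Y) : finfun inr \in Emb v (psum u v).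
Proof. by apply: mem_Emb => [? ? []|i x] //; rewrite psumE. Qed.

Lemma id_Emb X (t : psys X) : finfun id \in Emb t t.
Proof. exact: mem_Emb. Qed.

(** Splitting off one transitive part at a time ends at the empty action. The splitting is only up
    to isomorphism, hence the first premise. *)
Lemma psys_ind (P : forall X, psys X -> Prop) :
  (forall X Y (t : psys X) (s : psys Y), iso t s -> P X t -> P Y s) ->
  (forall X (t : psys X), #|X| = 0 -> P X t) ->
  (forall X Y (c : psys X) (v : psys Y), transitive_psys c -> P Y v ->
     P (X + Y)%type (psum c v)) ->
  forall X (t : psys X), P X t.
Proof.
move=> Piso P0 Psum X t; have [n] := ubnP #|X|; elim: n => // n IHn in X t *.
rewrite ltnS => leXn; have [/eqP X0|X_gt0] := posnP #|X|; first exact/P0/eqP.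
have [Y [u [f [tu fE]]]] := transitive_sub t X_gt0.
have [Z [v [g [cX gE _]]]] := split_psys fE.
apply: Piso (Emb_iso _ gE) _; first by rewrite card_sum.
apply: Psum => //; apply: IHn; apply: leq_trans leXn; rewrite cX.
by case/andP: tu => Y_gt0 _; rewrite -[ltnLHS]add0n ltn_add2r.
Qed.

(** The points that an embedding sends to one given summand form an invariant set, so a transitive
    action lands entirely in one summand. *)
Lemma card_Emb_psum X Y Z (c : psys X) (u : psys Y) (v : psys Z) :
  transitive_psys c -> #|Emb c (psum u v)| = #|Emb c u| + #|Emb c v|.
Proof.
move=> tc; have [x0 _] := transitive_psys_pick tc.
pose L := (fun f => comp_ffun (finfun (@inl Y Z)) f) @: Emb c u.
pose R := (fun f => comp_ffun (finfun (@inr Y Z)) f) @: Emb c v.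
have Linj : injective (finfun (@inl Y Z)) by move=> x y; rewrite !ffunE => -[].
have Rinj : injective (finfun (@inr Y Z)) by move=> x y; rewrite !ffunE => -[].
rewrite -(card_imset _ (comp_ffun_injr (X := X) Linj)).
rewrite -(card_imset _ (comp_ffun_injr (X := X) Rinj)) -/L -/R.
suff -> : Emb c (psum u v) = L :|: R.
  rewrite cardsU [L :&: R](_ : _ = set0) ?cards0 ?subn0 //.
  apply/setP => f; rewrite !inE; apply/andP => -[/imsetP[g _ ->] /imsetP[h _]].
  by move/ffunP/(_ x0); rewrite !ffunE.
apply/setP => f; rewrite in_setU; apply/idP/orP; last first.
  case=> /imsetP[g gE ->]; apply: Emb_comp gE _.
    exact: inl_Emb.
  exact: inr_Emb.
case/EmbP=> fI fE.
pose isl (z : Y + Z) := if z is inl _ then true else false.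
have islE i z : isl (psum u v i z) = isl z by rewrite psumE; case: z.
case fx0 : (f x0) => [y0|z0].
  have /setP allL : [set x | isl (f x)] = setT.
    apply: (transitive_psysP (x := x0) tc) => [i x|]; rewrite !inE ?fx0 //.
    by rewrite fE islE.
  left; apply/imsetP; pose g x := if f x is inl y then y else y0.
  have fg x : f x = inl (g x).
    by have := allL x; rewrite !inE /g; case: (f x).
  exists (finfun g); last by apply/ffunP => x; rewrite !ffunE.
  apply: mem_Emb => [x y gxy|i x]; first by apply: fI; rewrite !fg gxy.
  by have := fE i x; rewrite psumE !fg /= => -[].
have /setP allR : [set x | ~~ isl (f x)] = setT.
  apply: (transitive_psysP (x := x0) tc) => [i x|]; rewrite !inE ?fx0 //.
  by rewrite fE islE.
right; apply/imsetP; pose g x := if f x is inr y then y else z0.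
have fg x : f x = inr (g x).
  by have := allR x; rewrite !inE /g; case: (f x).
exists (finfun g); last by apply/ffunP => x; rewrite !ffunE.
apply: mem_Emb => [x y gxy|i x]; first by apply: fI; rewrite !fg gxy.
by have := fE i x; rewrite psumE !fg /= => -[].
Qed.

Lemma Emb_transitive X Y (c : psys X) (u : psys Y) f :
  0 < #|X| -> transitive_psys u -> f \in Emb c u -> iso c u.
Proof.
case/card_gt0P=> x0 _ tu fE; apply: Emb_iso (fE); case/EmbP: fE => fI fE.
rewrite -(card_imset _ fI).
rewrite (transitive_psysP (A := [set f x | x in X]) (x := f x0) tu) ?cardsT //.
  by move=> i _ /imsetP[x _ ->]; rewrite -fE imset_f.
exact: imset_f.
Qed.

Lemma card_Emb_transitive X Y (c : psys X) (u : psys Y) :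
  transitive_psys c -> transitive_psys u ->
  #|Emb c u| = if iso c u then #|Emb c c| else 0.
Proof.
move=> tc tu; case: ifPn => [cu|ncu]; first exact/esym/card_Emb_iso.
apply/eqP; rewrite cards_eq0 -[_ == _]negbK; apply: contra ncu.
by case/set0Pn=> f; apply: Emb_transitive tu; case/andP: tc.
Qed.

Lemma card_Emb_gt0 X (c : psys X) : 0 < #|Emb c c|.
Proof. by rewrite card_gt0; case/andP: (iso_refl c). Qed.

(* An isomorphism f : c + v -> c + v' either preserves the summand c or moves
   it into v'; in both cases following f until one leaves c gives v -> v'. *)
Lemma psum_cancel X Y Z (c : psys X) (v : psys Y) (v' : psys Z) :
  transitive_psys c -> iso (psum c v) (psum c v') -> iso v v'.
Proof.
move=> tc /isoP[]; rewrite !card_sum => /addnI cYZ [f /EmbP[fI fE]].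
pose h y := match f (inr y) with
  | inr z => Some z
  | inl x => if f (inl x) is inr z then Some z else None
  end.
have hS y : h y : bool.
  rewrite /h; case fy: (f (inr y)) => [x|z] //; case fx: (f (inl x)) => [x'|z] //.
  (* If [f] maps some point of [c] into [c], the part of [c] hit from [c] is nonempty and invariant,
     hence all of [c]; then [inl x] would have a preimage in both summands. *)
  pose fX := [set x1 | [exists x2, f (inl x2) == inl x1]].
  have invX i x1 : x1 \in fX -> c i x1 \in fX.
    rewrite !inE => /existsP[x2 /eqP fx2]; apply/existsP; exists (c i x2).
    by have := fE i (inl x2); rewrite fx2 !psumE /= => ->.
  have: x \in fX.
    rewrite (@transitive_psysP _ _ fX x' tc) ?inE //.
    by apply/existsP; exists x; rewrite fx.
  rewrite inE => /existsP[x2 /eqP]; rewrite -fy => /fI //.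
have [g hg] : exists g, forall y, h y = Some (g y).
  apply: (fin_all_exists (P := fun y z => h y = Some z)) => y.
  by case: (h y) (hS y) => // z _; exists z.
apply: (@Emb_iso _ _ _ _ (finfun g)) => //; apply: mem_Emb => [y y' gyy'|i y].
  have: h y = h y' by rewrite !hg gyy'.
  rewrite /h; case fy: (f (inr y)) => [x|z]; case fy': (f (inr y')) => [x'|z'].
  - case fx: (f (inl x)) => [x1|z1]; case fx': (f (inl x')) => [x1'|z1'] //.
    + by have := hS y; rewrite /h fy fx.
    + case=> eqz; rewrite eqz -fx' in fx; have [eqx] := fI _ _ fx.
      by rewrite eqx -fy' in fy; have [] := fI _ _ fy.
  - case fx: (f (inl x)) => [x1|z1] // [eqz].
    by rewrite eqz -fy' in fx; have := fI _ _ fx.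
  - case fx': (f (inl x')) => [x1|z1] // [eqz].
    by rewrite -eqz -fy in fx'; have := fI _ _ fx'.
  - by case=> eqz; rewrite eqz -fy' in fy; have [] := fI _ _ fy.
have: h (v i y) = omap (v' i) (h y).
  have := fE i (inr y); rewrite /h psumE /= => ->; rewrite psumE.
  case: (f (inr y)) => [x|z] //=; have := fE i (inl x); rewrite psumE /= => ->.
  by rewrite psumE; case: (f (inl x)).
by rewrite !hg => -[].
Qed.

(** Automorphisms of the sum are sorted by their restriction to [c]. All fibres have the size of the
    one over [inl], which consists of the automorphisms of [v]. *)
Lemma card_Aut_psum X Y (c : psys X) (v : psys Y) :
  transitive_psys c ->
  #|Emb (psum c v) (psum c v)| = #|Emb c (psum c v)| * #|Emb v v|.
Proof.
move=> tc; set cv := psum c v.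
pose res (F : {ffun X + Y -> X + Y}) := [ffun x => F (inl x)].
have resE F : F \in Emb cv cv -> res F \in Emb c cv.
  move=> FE; have -> : res F = comp_ffun F (finfun inl).
    by apply/ffunP => x; rewrite !ffunE.
  exact: Emb_comp (inl_Emb c v) FE.
pose fib f := [set F in Emb cv cv | res F == f].
have leq_fib f f' G : G \in Emb cv cv -> comp_ffun G f = f' -> #|fib f| <= #|fib f'|.
  move=> GE Gf; have /EmbP[GI _] := GE.
  rewrite -(card_imset _ (comp_ffun_injr (X := (X + Y)%type) GI)).
  apply/subset_leq_card/subsetP => _ /imsetP[F FE ->]; move: FE; rewrite in_set.
  case/andP=> FE /eqP rF; rewrite in_set (Emb_comp FE GE) -Gf -rF.
  by apply/eqP/ffunP => x; rewrite !ffunE.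
have card_fib f : f \in Emb c cv -> #|fib f| = #|fib (finfun inl)|.
  move=> fE; have [Z [w [g [cYZ gE gf]]]] := split_psys fE.
  have vw : iso v w.
    apply: (psum_cancel tc); apply: iso_sym; apply: Emb_iso gE.
    by rewrite cYZ card_sum.
  have /isoP[cvw [h hE]] := vw.
  (* Cancellation gave [v] isomorphic to [w], so [G] is an automorphism of [cv] that restricts to
     [f]; composing with it and with its inverse compares the fibres. *)
  have GE := Emb_comp (Emb_sum (id_Emb c) hE) gE; set G := comp_ffun _ _ in GE.
  have Gf : comp_ffun G (finfun inl) = f by apply/ffunP => x; rewrite !ffunE gf.
  apply/eqP; rewrite eqn_leq; apply/andP; split; last exact: (leq_fib _ _ G).
  have /EmbP[GI GEq] := GE.
  have /inj_card_bij[|G' GK G'K] := GI; first by [].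
  apply: (leq_fib _ _ (finfun G')).
    apply: mem_Emb => [|i z]; first exact: can_inj G'K.
    by apply: GI; rewrite G'K GEq G'K.
  apply/ffunP => x; rewrite -Gf [LHS]ffunE [RHS]ffunE ffunE.
  by apply: (canLR GK); rewrite [LHS]ffunE; congr (G _); rewrite ffunE.
have card_fib0 : #|fib (finfun inl)| = #|Emb v v|.
  pose j (w : {ffun Y -> Y}) := sum_ffun (finfun (@id X)) w.
  have jI : injective j.
    move=> w w' /ffunP eqj; apply/ffunP => y.
    by have := eqj (inr y); rewrite !ffunE => -[].
  rewrite -(card_imset _ jI); congr #|pred_of_set _|; apply/setP => F.
  rewrite in_set; apply/idP/imsetP; last first.
    case=> w wE ->; apply/andP; split; last by apply/eqP/ffunP => x; rewrite !ffunE.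
    exact: Emb_sum (id_Emb c) wE.
  case/andP=> /EmbP[FI FE] /eqP/ffunP resF.
  have Fl x : F (inl x) = inl x by have := resF x; rewrite !ffunE.
  pose w y := if F (inr y) is inr y' then y' else y.
  have Fr y : F (inr y) = inr (w y).
    by rewrite /w; case Fy: (F (inr y)) => [x|//]; rewrite -Fl in Fy; have := FI _ _ Fy.
  exists (finfun w); last by apply/ffunP => -[x|y]; rewrite !ffunE.
  apply: mem_Emb => [y y' eqw|i y].
    by have := FI (inr y) (inr y'); rewrite !Fr eqw => /(_ erefl) [].
  by have := FE i (inr y); rewrite !psumE /= !Fr /= => -[].
rewrite -card_fib0 -[LHS]sum1_card (partition_big res (mem (Emb c cv))) //=.
rewrite -sum_nat_const; apply: eq_bigr => f fE.
by rewrite -(card_fib f fE) -[RHS]sum1_card; apply: eq_bigl => F; rewrite [RHS]in_set.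
Qed.

End Systems.

(** * Counting isomorphism classes *)

Section Representatives.

Variable r : nat.
Implicit Types X Y : finType.

Lemma relabel_psys n X (t : psys r X) :
  #|X| = n -> exists s : psys r 'I_n, iso t s.
Proof.
move=> cX; pose f x := cast_ord cX (enum_rank x).
pose g i : X := enum_val (cast_ord (esym cX) i).
have fK : cancel f g by move=> x; rewrite /g cast_ordK enum_rankK.
have gK : cancel g f by move=> x; rewrite /f enum_valK cast_ordKV.
have pI i : injective (fun x => f (t i (g x))).
  by move=> x y /(can_inj fK)/perm_inj/(can_inj gK).
exists [ffun i => perm (pI i)]; apply: (@Emb_iso _ _ _ _ _ (finfun f)).
  by rewrite card_ord.
by apply: mem_Emb => [|i x]; [exact: can_inj fK | rewrite ffunE permE fK].
Qed.

(** The choice depends only on the predicate [iso t], so isomorphic actions get equal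
    representatives. The default occurs only if [#|X|] differs from [n]. *)
Definition canon n X (t : psys r X) : psys r 'I_n :=
  odflt [ffun=> 1%g] [pick s : psys r 'I_n | iso t s].

Lemma canonP n X (t : psys r X) : #|X| = n -> iso t (canon n t).
Proof.
move=> /(relabel_psys t)[s ts].
rewrite /canon.
by case: pickP => [s' ts'|/(_ s)/negP[//]]; exact ts'.
Qed.

Lemma eq_canon n X Y (t : psys r X) (s : psys r Y) :
  iso t s -> canon n t = canon n s.
Proof.
move=> ts; congr odflt; apply: eq_pick => w.
by apply/idP/idP; apply: iso_trans; rewrite // iso_sym.
Qed.

Lemma canon_iso n X Y (t : psys r X) (s : psys r Y) :
  #|X| = n -> #|Y| = n -> canon n t = canon n s -> iso t s.
Proof.
move=> cX cY eq_ts; apply: iso_trans (canonP t cX) _.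
by rewrite eq_ts iso_sym ?canonP.
Qed.

(** The cardinality is a_n of the overview; that of [trans_reps n] is c_n. *)
Definition reps n : {set psys r 'I_n} := [set canon n t | t : psys r 'I_n].

Lemma canon_reps n X (t : psys r X) : #|X| = n -> canon n t \in reps n.
Proof.
move=> cX; apply/imsetP; exists (canon n t) => //.
exact/eq_canon/canonP.
Qed.

Lemma reps_canon n (t : psys r 'I_n) : t \in reps n -> canon n t = t.
Proof.
case/imsetP=> s _ ->; apply/esym/eq_canon/canonP; exact: card_ord.
Qed.

Lemma reps_eq n (t s : psys r 'I_n) : t \in reps n -> s \in reps n ->
  iso t s -> t = s.
Proof. by move=> /reps_canon {2}<- /reps_canon {2}<-; apply: eq_canon. Qed.

Definition trans_reps n : {set psys r 'I_n} :=
  [set c in reps n | transitive_psys c].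

(** Only classes containing [c] contribute, and adding [c] maps [reps k] onto them by [split_psys],
    injectively by cancellation. *)
Lemma sum_Emb_rec X k (c : psys r X) : transitive_psys c ->
  \sum_(t in reps (#|X| + k)) #|Emb c t| =
    #|Emb c c| * #|reps k| + \sum_(v in reps k) #|Emb c v|.
Proof.
move=> tc; pose phi v := canon (#|X| + k) (psum c v : psys r (X + 'I_k)%type).
have c_sum (v : psys r 'I_k) : #|{: X + 'I_k}| = #|X| + k.
  by rewrite card_sum card_ord.
have phiI : {in reps k &, injective phi}.
  move=> v w vk wk /canon_iso - /(_ (c_sum v) (c_sum w)) /(psum_cancel tc).
  exact: reps_eq.
rewrite (big_setID (phi @: reps k)) /= (setIidPr _); last first.
  by apply/subsetP => _ /imsetP[v _ ->]; exact: canon_reps (c_sum v).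
rewrite [X in _ + X]big1 ?addn0 => [|t /setDP[tR]]; last first.
  apply: contraNeq; rewrite -lt0n card_gt0 => /set0Pn[f /split_psys].
  case=> Z [w [g [cZ gE _]]]; have ck : #|Z| = k.
    by apply/eqP; rewrite -(eqn_add2l #|X|) -cZ card_ord.
  apply/imsetP; exists (canon k w); first exact: canon_reps.
  rewrite -(reps_canon tR); apply: eq_canon; apply: iso_sym.
  apply: iso_trans (Emb_iso _ gE); last by rewrite card_sum ck card_ord.
  by apply: psum_iso; rewrite ?iso_refl // iso_sym // canonP.
rewrite big_imset //= mulnC -sum_nat_const -big_split /=; apply: eq_bigr => v _.
by rewrite -(card_Emb_iso _ (canonP _ (c_sum v))) card_Emb_psum.
Qed.

Lemma card_Emb0 X Y (c : psys r X) (t : psys r Y) :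
  #|Y| < #|X| -> #|Emb c t| = 0.
Proof.
move=> ltYX; apply/eqP; rewrite cards_eq0; apply: contraTT ltYX.
by case/set0Pn=> f /EmbP[/leq_card]; rewrite -leqNgt.
Qed.

Lemma sum_Emb X k (c : psys r X) : transitive_psys c ->
  \sum_(t in reps k) #|Emb c t| =
    #|Emb c c| * \sum_(1 <= m < k.+1 | #|X| %| m) #|reps (k - m)|.
Proof.
move=> tc; have X_gt0 : 0 < #|X| by case/andP: tc.
have [n] := ubnP k; elim: n => // n IHn in k *; rewrite ltnS => lekn.
have [ltkX|leXk] := ltnP k #|X|.
  rewrite big1 => [|t _]; last by rewrite card_Emb0 ?card_ord.
  rewrite big_nat_cond big1 ?muln0 // => m /andP[/andP[m_gt0 ltmk]].
  by move/(dvdn_leq m_gt0); rewrite leqNgt (leq_ltn_trans _ ltkX).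
rewrite -(subnKC leXk) sum_Emb_rec // IHn; last first.
  by rewrite (leq_trans _ lekn) // ltn_subrL X_gt0 (leq_trans X_gt0 leXk).
rewrite -mulnDr; congr (_ * _); rewrite (subnKC leXk).
(* The sum is cut at [#|X|]: no positive multiple lies below, the index [#|X|] itself yields the
   [reps] term, and a shift by [#|X|] matches the rest with the induction hypothesis. *)
rewrite [RHS](big_cat_nat _ (n := #|X|)) ?ltnS //=; last by rewrite ltnW.
rewrite [X in _ = X + _]big_nat_cond [X in _ = X + _]big1;
    last first => [m /andP[/andP[m_gt0 ltmX]]|].
  by move/(dvdn_leq m_gt0); rewrite leqNgt ltmX.
rewrite add0n [RHS]big_ltn_cond ?ltnS // dvdnn; congr (_ + _).
rewrite -[in RHS](add1n #|X|) big_addn subSn //.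
apply: eq_big => [m|m _]; first by rewrite dvdn_addl.
by rewrite subnDA [k - _ - _]subnAC.
Qed.

Local Open Scope ring_scope.

(** The quotient is the number of orbits of type [c], so each orbit contributes its size. Both sides
    are additive and agree on transitive actions; the free bound [D] keeps the range of [d] fixed
    during the induction. *)
Lemma sum_multiplicities X (t : psys r X) D : (#|X| <= D)%N ->
  \sum_(d < D.+1) \sum_(c in trans_reps d)
     d%:R * (#|Emb c t|%:R / #|Emb c c|%:R) = #|X|%:R :> rat.
Proof.
move: X t; apply: psys_ind => [X Y t s ts IH|X t X0 _|X Y u v tu IH].
- rewrite -(iso_card ts) => /IH <-.
  by apply: eq_bigr => d _; apply: eq_bigr => c _; rewrite (card_Emb_iso _ ts).
- rewrite X0 big1 // => d _; rewrite big1 // => c /setIdP[_ /andP[d_gt0 _]].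
  by rewrite card_Emb0 ?X0 // mul0r mulr0.
rewrite card_sum => leD; rewrite natrD -IH; last first.
  exact: leq_trans (leq_addl _ _) leD.
have ltXD : (#|X| < D.+1)%N by rewrite ltnS (leq_trans (leq_addr _ _) leD).
pose d0 : 'I_D.+1 := Ordinal ltXD.
have uR : canon d0 u \in trans_reps d0.
  by rewrite inE canon_reps //= (iso_transitive (canonP u _)).
have -> : #|X|%:R = \sum_(d < D.+1) \sum_(c in trans_reps d)
    d%:R * (#|Emb c u|%:R / #|Emb c c|%:R) :> rat.
  rewrite (bigD1 d0) //= [X in _ = _ + X]big1 => [|d ne_d]; last first.
    rewrite big1 // => c /setIdP[_ tc]; rewrite card_Emb_transitive //.
    case: ifPn => [/iso_card cd|]; last by rewrite mul0r mulr0.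
    by rewrite -val_eqE /= -cd card_ord eqxx in ne_d.
  rewrite addr0 (bigD1 (canon d0 u)) //= big1 => [|c /andP[/setIdP[cR tc] ne_c]].
    rewrite addr0 card_Emb_transitive //; last by case/setIdP: uR.
    rewrite iso_sym ?canonP // divff ?mulr1 //.
    by rewrite pnatr_eq0 -lt0n card_Emb_gt0.
  rewrite card_Emb_transitive //; case: ifPn => [cu|]; last by rewrite mul0r mulr0.
  by case/eqP: ne_c; rewrite -(eq_canon _ cu) reps_canon.
rewrite -big_split /=; apply: eq_bigr => d _.
rewrite -big_split /=; apply: eq_bigr => c /setIdP[_ tc].
by rewrite card_Emb_psum // natrD mulrDl mulrDr.
Qed.

(** This is [sum_multiplicities] summed over all [t]. After exchanging the sums, [sum_Emb] evaluates
    the sum over [t] and the factor [#|Emb c c|] cancels. *)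
Lemma card_reps_rec k :
  (k * #|reps k| = \sum_(1 <= m < k.+1)
     (\sum_(d < k.+1 | d %| m) d * #|trans_reps d|) * #|reps (k - m)|)%N.
Proof.
apply/eqP; rewrite -(eqr_nat rat) mulnC -sum_nat_const natr_sum; apply/eqP.
under eq_bigr => t _.
  rewrite -[in X in X%:R](card_ord k).
  rewrite -(@sum_multiplicities _ t k) ?card_ord //; over.
rewrite exchange_big natr_sum /=.
transitivity (\sum_(d < k.+1) \sum_(1 <= m < k.+1 | (d %| m)%N)
   (d * #|trans_reps d| * #|reps (k - m)|)%:R : rat).
  apply: eq_bigr => d _; rewrite exchange_big /=.
  rewrite -natr_sum -big_distrr /= -mulnA [(#|_| * _)%N]mulnC mulnA natrM.
  rewrite mulr_natr -sumr_const; apply: eq_bigr => c /setIdP[_ tc].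
  rewrite -mulr_sumr -mulr_suml -natr_sum sum_Emb // card_ord natrM.
  rewrite mulrAC divff ?mul1r ?natrM //.
  by rewrite pnatr_eq0 -lt0n card_Emb_gt0.
rewrite (exchange_big_dep predT) //=; apply: eq_bigr => m _.
by rewrite -natr_sum big_distrl.
Qed.

End Representatives.

(** * Simultaneous conjugacy as isomorphism of actions *)

Section Tuples.

Variables r d : nat.
Implicit Types t s : tuples r d.

(** The rule [(t i ^ h) (h x) = h (t i x)] makes conjugating permutations the same as
    isomorphisms. *)
Lemma conj_orbitP t s : reflect (iso (t : psys r 'I_d) s) (s \in conj_orbit t).
Proof.
apply: (iffP imsetP) => [[h _ ->]|/isoP[_ [f /EmbP[fI fE]]]].
  apply: (@Emb_iso _ _ _ _ _ (finfun h)) => //.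
  apply: mem_Emb => [|i x]; first exact: perm_inj.
  by rewrite ffunE permJ.
exists (perm fI) => //; apply/ffunP => i; apply/permP => x.
by rewrite ffunE -(permKV (perm fI) x) permJ !permE fE.
Qed.

Lemma conj_orbit_eq t s :
  (conj_orbit t == conj_orbit s) = iso (t : psys r 'I_d) s.
Proof.
apply/eqP/idP => [eq_ts|ts].
  by apply/conj_orbitP; rewrite eq_ts; apply/conj_orbitP/iso_refl.
apply/setP => w; apply/conj_orbitP/conj_orbitP.
  exact: iso_trans (iso_sym ts).
exact: iso_trans ts.
Qed.

Lemma card_conj_orbits (A : {set tuples r d}) :
  (forall t s, iso (t : psys r 'I_d) s -> t \in A -> s \in A) ->
  #|[set conj_orbit t | t in A]| = #|reps r d :&: A|.
Proof.
move=> isoA.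
have -> : [set conj_orbit t | t in A] = @conj_orbit r d @: (reps r d :&: A).
  apply/setP => O; apply/imsetP/imsetP => -[t tA ->]; last first.
    by exists t => //; case/setIP: tA.
  have ct : iso (t : psys r 'I_d) (canon d t) by apply: canonP; apply: card_ord.
  exists (canon d t); last by apply/eqP; rewrite conj_orbit_eq.
  by rewrite inE canon_reps ?card_ord //=; apply: isoA tA.
apply: card_in_imset => t s /setIP[tR _] /setIP[sR _] /eqP.
by rewrite conj_orbit_eq; apply: reps_eq.
Qed.

(** An invariant set is stable under the generated group, so it contains the orbits of its points;
    conversely the orbit of [x0] is invariant. *)
Lemma transitive_tupleE t : 0 < d ->
  transitive_tuple t = transitive_psys (t : psys r 'I_d).
Proof.
move=> d_gt0; rewrite /transitive_tuple /transitive_psys card_ord d_gt0 /=.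
set G := (<<_>>)%g; pose x0 : 'I_d := Ordinal d_gt0.
apply/idP/forallP => [trG A|trA].
  apply/implyP => tA; have [->|[x xA]] := set_0Vmem A; rewrite ?eqxx //.
  apply/orP; right; rewrite eqEsubset subsetT -(atransP trG x) ?inE //.
  rewrite acts_sub_orbit // gen_subG; apply/subsetP => _ /imsetP[i _ ->].
  by rewrite !inE /=; apply/subsetP => y yA; rewrite inE /= apermE invariant_setE.
apply/imsetP; exists x0; rewrite ?inE //; apply/esym/eqP.
have /implyP := trA (orbit 'P G x0).
have x0O : x0 \in orbit 'P G x0 by apply: orbit_refl.
case/(_ _)/orP => [|/eqP O0|//]; last by rewrite O0 inE in x0O.
apply/invariant_setP => i _ /orbitP[h hG <-].
apply/orbitP; exists (h * t i)%g; last by rewrite actM.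
by rewrite groupM // mem_gen // imset_f.
Qed.

Lemma num_transitive_classesE :
  0 < d -> num_transitive_classes r d = #|trans_reps r d|.
Proof.
move=> d_gt0; rewrite /num_transitive_classes card_conj_orbits => [|t s ts].
  by apply: eq_card => t; rewrite !inE transitive_tupleE.
by rewrite !inE !transitive_tupleE //; apply: iso_transitive.
Qed.

End Tuples.

(** * Cycle types and Burnside's lemma *)

Section CycleType.

Implicit Types X Y : finType.

Definition cyc n : psys 1 'I_n := [ffun=> perm (@ordS_inj n)].

Lemma cycE n i x : cyc n i x = ordS x.
Proof. by rewrite ffunE permE. Qed.

Lemma iter_ordS n k (x : 'I_n) : iter k (@ordS n) x = (x + k) %% n :> nat.
Proof.
elim: k => [|k IHk]; first by rewrite addn0 modn_small.
by rewrite iterS /= IHk -addn1 modnDml addn1 addnS.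
Qed.

Lemma transitive_cyc n : 0 < n -> transitive_psys (cyc n).
Proof.
move=> n_gt0; apply/andP; split; first by rewrite card_ord.
apply/forallP => A; apply/implyP => /invariant_setP cA.
have [->|[x xA]] := set_0Vmem A; rewrite ?eqxx //; apply/orP; right.
apply/eqP/setP => y; rewrite !inE.
(* From [x], the first [n - x] steps wrap around to 0 and [y] more reach [y], whichever of the two
   is larger. *)
suff -> : y = iter (n - x + y) (@ordS n) x.
  elim: (n - x + y) => //= k /(cA ord0); rewrite cycE; exact.
apply/val_inj; rewrite /= iter_ordS addnA subnKC; last exact/ltnW/ltn_ord.
by rewrite modnDl modn_small.
Qed.

(** The [i]-th iterate of [u] on [x] defines the map; it is injective since by transitivity the
    orbit of [x] has [#|X|] elements. The free choice of [x] serves to count automorphisms. *)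
Lemma Emb_cyc X (u : psys 1 X) x (i0 : 'I_#|X|) : transitive_psys u -> i0 = 0 :> nat ->
  exists2 f, f \in Emb (cyc #|X|) u & f i0 = x.
Proof.
move=> tu i0E; pose p := u ord0.
have px : #|porbit p x| = #|X|.
  rewrite -cardsT; congr #|pred_of_set _|.
  apply: (transitive_psysP (x := x) tu); last exact: porbit_id.
  move=> i _ /porbitP[n ->]; rewrite (ord1 i) -/p -permM -expgSr.
  exact: mem_porbit.
exists [ffun i : 'I_#|X| => iter i p x]; last by rewrite ffunE i0E.
apply: mem_Emb => [i j eq_ij|i j].
  apply/val_inj/eqP; rewrite -(nth_uniq x _ _ (uniq_traject_porbit p x));
    rewrite ?size_traject ?px ?ltn_ord //.
  by rewrite !nth_traject ?ltn_ord //; apply/eqP; exact: eq_ij.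
rewrite (ord1 i) cycE /= -/p -iterS.
have [eqj|ltj] : j.+1 = #|X| \/ j.+1 < #|X|.
  by have := ltn_ord j; rewrite leq_eqVlt => /orP[/eqP|]; [left|right].
  by rewrite eqj modnn -px iter_porbit.
by rewrite modn_small.
Qed.

Lemma iso_cyc n X (u : psys 1 X) : transitive_psys u -> #|X| = n -> iso (cyc n) u.
Proof.
move=> tu <-; have X_gt0 : 0 < #|X| by case/andP: tu.
have [x _] := transitive_psys_pick tu.
have [f fE _] := @Emb_cyc _ u x (Ordinal X_gt0) tu erefl.
by apply: Emb_iso fE; rewrite card_ord.
Qed.

(** An automorphism is determined by the image of 0, and [Emb_cyc] realises every image. *)
Lemma card_Aut_cyc n : 0 < n -> #|Emb (cyc n) (cyc n)| = n.
Proof.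
move=> n_gt0; pose i0 := Ordinal n_gt0.
have injE : {in Emb (cyc n) (cyc n) &, injective (fun f : {ffun 'I_n -> 'I_n} => f i0)}.
  move=> f g /EmbP[_ fE] /EmbP[_ gE] eq0; apply/ffunP => i.
  have -> : i = iter i (@ordS n) i0.
    by apply/val_inj; rewrite /= iter_ordS add0n modn_small.
  elim: (nat_of_ord i) => //= k IHk.
  have := gE ord0 (iter k (@ordS n) i0); have := fE ord0 (iter k (@ordS n) i0).
  by rewrite !cycE => -> ->; rewrite IHk.
rewrite -(card_in_imset injE) -[RHS]card_ord -cardsT; congr #|pred_of_set _|.
apply/setP => x; rewrite inE; apply/imsetP.
have /(Emb_cyc x) : transitive_psys (cyc n) by apply: transitive_cyc.
have cn := card_ord n; have n_gt0' : 0 < #|'I_n| by rewrite cn.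
case/(_ (Ordinal n_gt0') erefl) => f fE fx.
exists (finfun (fun i : 'I_n => f (cast_ord (esym cn) i))); last first.
  by rewrite ffunE -fx; congr (f _); apply/val_inj.
case/EmbP: fE => fI fE; apply: mem_Emb => [i j /fI/cast_ord_inj //|i j].
rewrite -(fE i) !cycE; congr (f _); apply/val_inj => /=.
by rewrite card_ord.
Qed.

(* A cycle of length j is the image of exactly j embeddings of cyc j, so this is
   the number of cycles of length j. *)
Definition mult j X (t : psys 1 X) := #|Emb (cyc j) t| %/ j.

Lemma eq_mult j X Y (t : psys 1 X) (s : psys 1 Y) : iso t s -> mult j t = mult j s.
Proof. by move=> ts; rewrite /mult (card_Emb_iso _ ts). Qed.

Lemma mult_big j X (t : psys 1 X) : #|X| < j -> mult j t = 0.
Proof. by move=> ltXj; rewrite /mult card_Emb0 ?card_ord ?div0n. Qed.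

Lemma card_Emb_cyc j X (u : psys 1 X) : 0 < j -> transitive_psys u ->
  #|Emb (cyc j) u| = (#|X| == j) * j.
Proof.
move=> j_gt0 tu; rewrite card_Emb_transitive //; last exact: transitive_cyc.
case: eqP => [cX|ne_cX]; first by rewrite iso_cyc // card_Aut_cyc // mul1n.
by case: ifP => // /iso_card; rewrite card_ord => cX; rewrite cX in ne_cX.
Qed.

Lemma mult_psum j X Y (c : psys 1 X) (v : psys 1 Y) : 0 < j -> transitive_psys c ->
  mult j (psum c v) = (#|X| == j) + mult j v.
Proof.
move=> j_gt0 tc; rewrite /mult card_Emb_psum; last exact: transitive_cyc.
by rewrite card_Emb_cyc // divnDl ?dvdn_mull // mulnK.
Qed.

(** The division in [mult] is exact: every transitive part contributes either [j] embeddings or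
    none. *)
Lemma card_Emb_mult j X (t : psys 1 X) : 0 < j -> #|Emb (cyc j) t| = mult j t * j.
Proof.
move=> j_gt0; move: X t; apply: psys_ind => [X Y t s ts IH|X t X0|X Y c v tc IH].
- by rewrite -(card_Emb_iso _ ts) -(eq_mult _ ts).
- by rewrite mult_big ?X0 // card_Emb0 // X0 card_ord.
rewrite mult_psum // card_Emb_psum; last exact: transitive_cyc.
by rewrite card_Emb_cyc // IH mulnDl.
Qed.

Lemma sum_mult D X (t : psys 1 X) : #|X| <= D ->
  \sum_(j < D) j.+1 * mult j.+1 t = #|X|.
Proof.
move: X t; apply: psys_ind => [X Y t s ts IH|X t X0 _|X Y c v tc IH].
- rewrite -(iso_card ts) => /IH <-.
  by apply: eq_bigr => j _; rewrite (eq_mult _ ts).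
- by rewrite big1 ?X0 // => j _; rewrite mult_big ?X0 ?muln0.
rewrite card_sum => leD; rewrite -(IH (leq_trans (leq_addl _ _) leD)).
under eq_bigr do rewrite mult_psum // mulnDr.
rewrite big_split /=; congr (_ + _).
have X_gt0 : 0 < #|X| by case/andP: tc.
have ltD : #|X|.-1 < D by rewrite prednK // (leq_trans (leq_addr _ _) leD).
rewrite (bigD1 (Ordinal ltD)) //= big1 => [|j].
  by rewrite prednK // eqxx muln1 addn0.
rewrite -val_eqE /= => ne_j; case: eqP => [cX|_]; last by rewrite muln0.
by rewrite cX eqxx in ne_j.
Qed.

(** Adding a cycle of length j to an action with m of them multiplies the number of automorphisms by
    j (m + 1), by [card_Aut_psum]; the corresponding factor of the product grows by the same
    amount. *)
Lemma card_Aut_mult D X (t : psys 1 X) : #|X| <= D ->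
  #|Emb t t| = \prod_(j < D) (j.+1 ^ mult j.+1 t * (mult j.+1 t)`!).
Proof.
move: X t; apply: psys_ind => [X Y t s ts IH|X t X0 _|X Y c v tc IH].
- rewrite -(iso_card ts) -(card_Emb_iso _ ts) -(card_Emb_isol _ ts) => /IH ->.
  by apply: eq_bigr => j _; rewrite (eq_mult _ ts).
- rewrite big1 => [|j _]; last by rewrite mult_big ?X0.
  apply/eqP; rewrite eqn_leq card_Emb_gt0 andbT.
  by rewrite (leq_trans (max_card _)) // card_ffun X0.
rewrite card_sum => leD; rewrite card_Aut_psum //.
have X_gt0 : 0 < #|X| by case/andP: tc.
rewrite -(card_Emb_isol _ (iso_cyc tc erefl)) card_Emb_mult // mult_psum // eqxx.
rewrite (IH (leq_trans (leq_addl _ _) leD)).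
have ltD : #|X|.-1 < D by rewrite prednK // (leq_trans (leq_addr _ _) leD).
rewrite (bigD1 (Ordinal ltD)) // [in RHS](bigD1 (Ordinal ltD)) //= prednK //.
rewrite mult_psum // eqxx add1n factS expnS mulnA; congr (_ * _).
  by rewrite [_.+1 * _]mulnC mulnACA.
apply: eq_bigr => j; rewrite -val_eqE /= => ne_j; rewrite mult_psum //.
by case: eqP => // cX; rewrite cX eqxx in ne_j.
Qed.

(** A cycle of [t] has a counterpart of equal length in [s], where its multiplicity is positive;
    both are split off and the rests compared by induction. *)
Lemma mult_iso X Y (t : psys 1 X) (s : psys 1 Y) :
  (forall j, mult j.+1 t = mult j.+1 s) -> iso t s.
Proof.
move: X t Y s; apply: (@psys_ind _ (fun X t => forall Y (s : psys 1 Y), _ -> iso t s)).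
- move=> X X' t t' tt' IH Y s eq_ms; apply: iso_trans (iso_sym tt') _.
  by apply: IH => j; rewrite (eq_mult _ tt').
- move=> X t X0 Y s eq_ms.
  have Y0 : #|Y| = 0.
    rewrite -(@sum_mult _ _ s (leqnn _)) big1 // => j _.
    by rewrite -eq_ms mult_big ?X0 ?muln0.
  have nX (x : X) : False by have /card0_eq/(_ x) := X0.
  apply: (@Emb_iso _ _ _ _ _ (finfun (fun x => False_rect Y (nX x)))).
    by rewrite X0.
  by apply: mem_Emb => [x|i x]; case: (nX x).
move=> X Z c v tc IH Y s eq_ms; have X_gt0 : 0 < #|X| by case/andP: tc.
have /set0Pn[f /split_psys[W [w [g [cY gE _]]]]] : Emb c s != set0.
  rewrite -card_gt0 -(card_Emb_isol _ (iso_cyc tc erefl)) card_Emb_mult //.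
  by rewrite muln_gt0 X_gt0 andbT -(prednK X_gt0) -eq_ms mult_psum // prednK // eqxx.
have ws : iso (psum c w) s by apply: Emb_iso gE; rewrite card_sum.
apply: iso_trans (ws); apply: psum_iso (iso_refl c) _; apply: IH => j.
by have := eq_ms j; rewrite -(eq_mult _ ws) !mult_psum // => /addnI.
Qed.

Lemma mult_exists D (m : nat -> nat) : (forall j, D <= j -> m j = 0) ->
  exists X (t : psys 1 X), forall j, mult j.+1 t = m j.
Proof.
have [n] := ubnP (\sum_(j < D) m j); elim: n => // n IHn in m *.
rewrite ltnS => le_n m0; have [/existsP[j0 mj0]|] := boolP [exists j0 : 'I_D, 0 < m j0].
  have [||X [t tE]] := IHn (fun j => m j - (j == j0)).
  - apply: leq_trans le_n; rewrite (bigD1 j0) // [in leqRHS](bigD1 j0) //= eqxx.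
    rewrite -addSn leq_add // ?leq_sum // ?subn1 ?prednK // => j _.
    exact: leq_subr.
  - by move=> j /m0 ->.
  exists ('I_j0.+1 + X)%type, (psum (cyc j0.+1) t) => j.
  rewrite mult_psum //; last exact: transitive_cyc.
  rewrite tE card_ord eqSS eq_sym; case: eqP => [->|_]; rewrite ?subn0 //.
  by rewrite subnKC.
rewrite negb_exists => /forallP m0'.
exists 'I_0, [ffun=> 1%g] => j; rewrite mult_big ?card_ord //.
have [/m0 //|ltj] := leqP D j.
by have := m0' (Ordinal ltj); rewrite -eqn0Ngt => /eqP.
Qed.

End CycleType.

(** * Centralizers, conjugacy classes and orbit counting in the symmetric group *)

Section Burnside.

Variable k : nat.
Implicit Types g h : 'S_k.

Definition one_psys h : psys 1 'I_k := [ffun=> h].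

Lemma one_psysE h i : one_psys h i = h. Proof. by rewrite ffunE. Qed.

Lemma card_cent1_perm h : #|'C[h]%g| = #|Emb (one_psys h) (one_psys h)|.
Proof.
have vI : injective (fun p : 'S_k => finfun p).
  by move=> p q /ffunP eq_pq; apply/permP => x; have := eq_pq x; rewrite !ffunE.
rewrite -(card_imset _ vI); congr #|pred_of_set _|; apply/setP => f.
apply/imsetP/idP => [[p /cent1P ph ->]|/EmbP[fI fE]].
  apply: mem_Emb => [|i x]; first exact: perm_inj.
  by rewrite one_psysE -!permM ph.
exists (perm fI); last by apply/ffunP => x; rewrite ffunE permE.
apply/cent1P/permP => x; rewrite !permM !permE.
by have := fE ord0 x; rewrite !one_psysE.
Qed.

Lemma iso_one_psys g h : iso (one_psys g) (one_psys h) = (h \in g ^: setT)%g.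
Proof.
apply/isoP/imsetP => [[_ [f /EmbP[fI fE]]]|[p _ ->]].
  exists (perm fI) => //; apply/permP => y.
  have [x ->] : exists x, y = perm fI x.
    by exists ((perm fI)^-1%g y); rewrite permKV.
  by have := fE ord0 x; rewrite !one_psysE permJ !permE => ->.
split=> //; exists (finfun p); apply: mem_Emb => [|i x]; first exact: perm_inj.
by rewrite !one_psysE permJ.
Qed.

(** Entry [j] counts cycles of length [j.+1], as in [is_partition]. By [sum_mult] the value is at
    most [k], so [inord] keeps it. *)
Definition cycle_type h : {ffun 'I_k -> 'I_k.+1} :=
  [ffun j : 'I_k => inord (mult j.+1 (one_psys h))].

Lemma cycle_typeE h (j : 'I_k) : cycle_type h j = mult j.+1 (one_psys h) :> nat.
Proof.
rewrite ffunE inordK // ltnS.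
have := @sum_mult k _ (one_psys h); rewrite card_ord => /(_ (leqnn _)) eqk.
apply: leq_trans (eq_leq eqk).
by rewrite (bigD1 j) //= mulSn -addnA leq_addr.
Qed.

Lemma cycle_type_partition h : is_partition (cycle_type h).
Proof.
rewrite /is_partition; apply/eqP; rewrite -[RHS]card_ord.
rewrite -(@sum_mult k _ (one_psys h)) ?card_ord //.
by apply: eq_bigr => j _; rewrite cycle_typeE.
Qed.

Lemma zk_cycle_type h : zk (cycle_type h) = #|'C[h]%g|.
Proof.
rewrite card_cent1_perm (@card_Aut_mult k) ?card_ord //.
by apply: eq_bigr => j _; rewrite cycle_typeE.
Qed.

Lemma cycle_type_eq g h : (cycle_type g == cycle_type h) = (g \in h ^: setT)%g.
Proof.
rewrite -iso_one_psys; apply/eqP/idP => [eq_gh|hg]; last first.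
  apply/ffunP => j; apply: ord_inj.
  by apply: etrans (cycle_typeE g j) _; rewrite -(eq_mult _ hg); exact/esym/cycle_typeE.
(* Lengths above [k] lie outside the vectors, but their multiplicities vanish on both sides. *)
apply: mult_iso => j; have [ltjk|lekj] := ltnP j k.
  by rewrite -!(cycle_typeE _ (Ordinal ltjk)) eq_gh.
by rewrite !mult_big ?card_ord.
Qed.

Lemma cycle_type_surj (m : {ffun 'I_k -> 'I_k.+1}) :
  is_partition m -> exists h, cycle_type h = m.
Proof.
move/eqP=> partm; pose m' j := if insub j is Some i then nat_of_ord (m i) else 0.
have m'E (j : 'I_k) : m' j = m j by rewrite /m' valK.
have m'0 j : k <= j -> m' j = 0 by move=> lekj; rewrite /m' insubN // -leqNgt.
have [X [t tE]] := mult_exists m'0.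
have cX : #|X| = k.
  (* The bound [maxn #|X| k] is taken because [#|X| = k] is still to be shown; [m'] vanishes from
     [k] on. *)
  rewrite -(sum_mult t (leq_maxl _ k)) -[RHS]partm.
  under [RHS]eq_bigr do rewrite -m'E.
  rewrite (big_ord_widen _ (fun j => j.+1 * m' j) (leq_maxr #|X| k)).
  rewrite [RHS]big_mkcond; apply: eq_bigr => j _; rewrite tE.
  by case: ltnP => // /m'0 ->; rewrite muln0.
have [s ts] := relabel_psys t cX.
exists (s ord0); have sE : s = one_psys (s ord0).
  by apply/ffunP => i; rewrite (ord1 i) one_psysE.
apply/ffunP => j; apply: ord_inj; rewrite cycle_typeE -sE -(eq_mult _ ts) tE.
exact: m'E.
Qed.

Lemma card_cycle_type (m : {ffun 'I_k -> 'I_k.+1}) : is_partition m ->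
  #|[set h | cycle_type h == m]| * zk m = k`!.
Proof.
case/cycle_type_surj=> h <-; rewrite zk_cycle_type.
have -> : [set g | cycle_type g == cycle_type h] = (h ^: [set: 'S_k])%g.
  by apply/setP => g; rewrite inE cycle_type_eq.
by rewrite -index_cent1 setTI mulnC Lagrange ?subsetT // cardsT card_Sn.
Qed.

Variable r : nat.

Lemma conj_tuple1 (t : tuples r k) : conj_tuple t 1 = t.
Proof. by apply/ffunP => i; rewrite ffunE conjg1. Qed.

Lemma conj_tupleM (t : tuples r k) g h :
  conj_tuple t (g * h) = conj_tuple (conj_tuple t g) h.
Proof. by apply/ffunP => i; rewrite !ffunE conjgM. Qed.

Definition conj_action := TotalAction conj_tuple1 conj_tupleM.

Lemma card_fix_conj h : #|'Fix_conj_action[h]%g| = #|'C[h]%g| ^ r.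
Proof.
rewrite -[in RHS](card_ord r) -card_ffun_on; apply: eq_card => t.
apply/afix1P/ffun_onP => [/= /ffunP th i|th].
  by have := th i; rewrite ffunE => thi; exact/cent1P/commgP/conjg_fixP.
apply/ffunP => i; rewrite ffunE; apply/conjg_fixP/commgP/cent1P.
exact: th.
Qed.

Lemma sum_cent1_pow : \sum_(h : 'S_k) #|'C[h]%g| ^ r = #|reps r k| * k`!.
Proof.
have acts : [acts [set: {perm 'I_k}], on [set: tuples r k] | conj_action]%g.
  by apply/actsP => h _ t; rewrite !inE.
have := Frobenius_Cauchy acts; rewrite cardsT card_Sn.
rewrite (eq_bigl predT) => [|h]; last by rewrite !inE.
under eq_bigr do rewrite setTI card_fix_conj.
move=> ->; congr (_ * _); rewrite -[reps r k]setIT.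
rewrite -card_conj_orbits => [|t s _ _]; last by rewrite inE.
congr #|pred_of_set _|; apply: eq_imset => t.
by apply/setP => s; apply/imsetP/imsetP => -[h _ ->]; exists h; rewrite ?inE.
Qed.

End Burnside.

(** In the Burnside sum, a cycle type with centralizer order z has k!/z permutations, each adding
    z^r; division by k! leaves z^(r-1). *)
Lemma card_reps_Zsum r k : 0 < r -> (#|reps r k|%:R = Zsum r k)%R.
Proof.
case: r => // r _; apply: (mulIf (x := (k`!)%:R%R)).
  by rewrite pnatr_eq0 -lt0n fact_gt0.
rewrite -natrM -sum_cent1_pow /Zsum /= mulr_suml natr_sum.
rewrite (partition_big (@cycle_type k) (@is_partition k)) => [|h _]; last first.
  exact: cycle_type_partition.
apply: eq_bigr => m partm; rewrite -(card_cycle_type partm) -natrX -natrM.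
rewrite -natr_sum; congr _%:R%R.
rewrite mulnC -mulnA -expnS -sum_nat_const.
apply: eq_big => [h|h /eqP <-]; first by rewrite inE.
by rewrite zk_cycle_type.
Qed.

Local Open Scope ring_scope.

(** * Coefficients of the logarithm *)

Section LogarithmCoefficients.

(** The product of the series exp (y_k T) is exp (T sum y_k), read at T^l. The outer variable T has
    polynomial coefficients [y k], and truncation at [M] does not reach degree [l]. *)
Lemma coef_prod_exp (I : Type) (s : seq I) (y : I -> {poly rat}) M l :
  (l <= M)%N ->
  (\prod_(k <- s) \poly_(i < M.+1) (i`!%:R^-1 *: y k ^+ i))`_l =
    l`!%:R^-1 *: (\sum_(k <- s) y k) ^+ l.
Proof.
elim: s => [|k s IHs] in l *.
  rewrite !big_nil coef1 expr0n; case: l => [|l] _ /=; last by rewrite scaler0.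
  by rewrite fact0 invr1 scale1r.
move=> lelM; rewrite !big_cons coefM addrC exprDn scaler_sumr.
apply: eq_bigr => i _; have leil : (i <= l)%N by rewrite -ltnS.
rewrite coef_poly ltnS (leq_trans leil lelM) IHs; last first.
  exact: leq_trans (leq_subr _ _) lelM.
rewrite -scalerAl -scalerAr scalerA -scaler_nat scalerA mulrC [in RHS]mulrC.
rewrite [_ * y k ^+ i]mulrC; congr (_ *: _).
rewrite -(bin_fact leil) !natrM !invfM [RHS]mulrA divff ?mul1r 1?mulrC //.
by rewrite pnatr_eq0 -lt0n bin_gt0.
Qed.

Variable a : nat -> rat.

(** For [0 < m] this is the coefficient of x^m in log (1 + sum_(k >= 1) a_k x^k); [inner_sum r] is
    the case [a = Zsum r]. *)
Definition log_coef m : rat :=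
  \sum_(n : {ffun 'I_m -> 'I_m.+1} | is_partition n)
    let l := (\sum_(k < m) n k)%N in
    (-1) ^+ l.-1 * (l.-1)`!%:R / (\prod_(k < m) (n k)`!)%:R
    * \prod_(k < m) a k.+1 ^+ n k.

Definition pos_part N : {poly rat} := \sum_(k < N) a k.+1 *: 'X^(k.+1).

Lemma coef_pos_part N i : (i <= N)%N -> (pos_part N)`_i = (0 < i)%N%:R * a i.
Proof.
case: i => [|i] leiN; rewrite coef_sum.
  by rewrite mul0r big1 // => k _; rewrite coefZ coefXn mulr0.
rewrite (bigD1 (Ordinal leiN)) //= coefZ coefXn eqxx mulr1 mul1r.
rewrite big1 ?addr0 // => k; rewrite -val_eqE /= => ne_ki.
by rewrite coefZ coefXn eqSS eq_sym (negPf ne_ki) mulr0.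
Qed.

Lemma coef_pos_part_exp N m l i : (m <= N)%N -> (i <= m)%N ->
  (pos_part N ^+ l)`_i = (pos_part m ^+ l)`_i.
Proof.
move=> lemN; elim: l i => [|l IHl] i leim; first by rewrite !expr0.
rewrite !exprS !coefM; apply: eq_bigr => j _; have leji : (j <= i)%N by rewrite -ltnS.
rewrite IHl; last exact: leq_trans (leq_subr _ _) leim.
rewrite !coef_pos_part ?(leq_trans leji) //; exact: leq_trans lemN.
Qed.

Lemma coef_pos_part_small N l i : (i < l)%N -> (pos_part N ^+ l)`_i = 0.
Proof.
have -> : pos_part N = 'X * \sum_(k < N) a k.+1 *: 'X^k.
  by rewrite mulr_sumr; apply: eq_bigr => k _; rewrite -scalerAr exprS.
by move=> ltil; rewrite exprMn coefXnM ltil.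
Qed.

(** In [coef_prod_exp] with [y k = a k.+1 *: 'X^(k.+1)], the length of [n] is the degree in the
    outer variable and the partitioned number is the degree in ['X]; the two conditions pick one
    coefficient. *)
Lemma sum_partitions_length m l : (l <= m)%N ->
  \sum_(n : {ffun 'I_m -> 'I_m.+1} | is_partition n && (\sum_(k < m) n k == l)%N)
     \prod_(k < m) ((n k)`!%:R^-1 * a k.+1 ^+ n k) =
  l`!%:R^-1 * (pos_part m ^+ l)`_m.
Proof.
move=> lelm; rewrite -coefZ.
have := coef_prod_exp (index_enum 'I_m) (fun k => a k.+1 *: 'X^(k.+1)) lelm.
rewrite -/(pos_part m) => <-.
under eq_bigr => k _ do rewrite poly_def.
rewrite bigA_distr_bigA /= !coef_sum big_mkcond /=; apply: eq_bigr => n _.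
under [in RHS]eq_bigr => k _ do rewrite exprZn -exprM scalerA.
rewrite [in RHS]scaler_prod.
rewrite prodrXr coefZ coefXn scaler_prod prodrXr [l == _]eq_sym.
case: (_ == l); last by rewrite andbF mulr0 coef0.
rewrite andbT mulr1 coefZ coefXn [m == _]eq_sym /is_partition.
by case: (_ == m); rewrite ?mulr1 ?mulr0.
Qed.

(** Grouped by length l, the product of (l-1)! and 1/l! is 1/l, as in the logarithm series. *)
Lemma log_coefE m : (0 < m)%N ->
  log_coef m = \sum_(l < m) ((-1) ^+ l / l.+1%:R) * (pos_part m ^+ l.+1)`_m.
Proof.
move=> m_gt0; have len_le (n : {ffun 'I_m -> 'I_m.+1}) : is_partition n ->
    (\sum_(k < m) n k <= m)%N.
  move/eqP=> partn; apply: leq_trans (eq_leq partn).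
  by apply: leq_sum => k _; rewrite leq_pmull.
have len_gt0 (n : {ffun 'I_m -> 'I_m.+1}) : is_partition n ->
    (0 < \sum_(k < m) n k)%N.
  move=> /eqP partn; rewrite lt0n; apply: contraTneq m_gt0 => n0.
  rewrite -partn big1 // => k _; apply/eqP; rewrite muln_eq0 /=.
  by move/eqP: n0; rewrite sum_nat_eq0 => /forallP/(_ k).
pose p (n : {ffun 'I_m -> 'I_m.+1}) : 'I_m :=
  insubd (Ordinal m_gt0) (\sum_(k < m) n k).-1%N.
have pE n : is_partition n -> (p n).+1 = (\sum_(k < m) n k)%N.
  move=> partn; have n_gt0 := len_gt0 n partn.
  by rewrite insubdK ?prednK //= unfold_in prednK ?len_le.
rewrite /log_coef (partition_big p predT) //=; apply: eq_bigr => l _.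
transitivity ((-1) ^+ l * l`!%:R * (l.+1`!%:R^-1 * (pos_part m ^+ l.+1)`_m));
    last first.
  rewrite factS natrM invfM -!mulrA; congr (_ * _); rewrite mulrCA; congr (_ * _).
  by rewrite mulVKf // pnatr_eq0 -lt0n fact_gt0.
rewrite -sum_partitions_length // mulr_sumr.
apply: eq_big => [n|n /andP[partn /eqP pl]].
  by case: (boolP (is_partition n)) => //= partn; rewrite -pE // eqSS val_eqE.
rewrite -pE //= pl -!mulrA; congr (_ * (_ * _)).
by rewrite big_split /= natr_prod prodfV.
Qed.

(** For positive [k] this compares coefficients in F' = F (log F)', where F is the series with
    coefficients [a]. *)
Lemma log_coef_rec k : a 0 = 1 ->
  k%:R * a k = \sum_(1 <= m < k.+1) m%:R * log_coef m * a (k - m)%N.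
Proof.
move=> a0; case: k => [|k]; first by rewrite mul0r big_geq.
set N := k.+1; pose A := pos_part N.
(* Truncating the logarithm after [A ^+ N] keeps all coefficients up to [N], since [A ^+ l] starts
   in degree [l] or later. *)
pose L : {poly rat} := \sum_(l < N) ((-1) ^+ l / l.+1%:R) *: A ^+ l.+1.
have coefL m : (0 < m <= N)%N -> L`_m = log_coef m.
  case/andP=> m_gt0 lemN; rewrite log_coefE // coef_sum.
  rewrite (big_ord_widen _
    (fun l => (-1) ^+ l / l.+1%:R * (pos_part m ^+ l.+1)`_m) lemN).
  rewrite [RHS]big_mkcond; apply: eq_bigr => l _; rewrite coefZ.
  rewrite (coef_pos_part_exp _ lemN) //; case: ltnP => // leml.
  by rewrite coef_pos_part_small ?mulr0.
(* The derivative of [L] is that of [A] times a geometric sum in [- A], which the factor [1 + A]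
   telescopes. The error [(- A) ^+ N] has no terms below degree [N = k.+1] and is invisible at
   degree [k]. *)
have dL : (1 + A) * L^`() = A^`() * (1 - (- A) ^+ N).
  have -> : L^`() = A^`() * \sum_(l < N) (- A) ^+ l.
    rewrite raddf_sum mulr_sumr; apply: eq_bigr => l _ /=.
    rewrite derivZ deriv_exp -mulrnAr scalerAr; congr (_ * _).
    rewrite -scaler_nat scalerA divfK ?pnatr_eq0 //.
    by rewrite -[- A]scaleN1r exprZn.
  rewrite mulrCA; congr (_ * _).
  by rewrite -[1 - _]opprB subrX1 -mulNr opprB opprK.
have := congr1 (fun p : {poly rat} => p`_k) dL.
rewrite mulrBr mulr1 coefB coef_deriv coef_pos_part // mul1r.
rewrite [X in _ - X](_ : _ = 0); last first.
  rewrite coefM big1 // => i _; rewrite -scaleN1r exprZn coefZ.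
  by rewrite coef_pos_part_small ?mulr0 // ltnS leq_subr.
rewrite subr0 -[a _ *+ _]mulr_natl => <-; rewrite coefMr big_add1 big_mkord.
apply: eq_bigr => j _; have lejk : (j <= k)%N by rewrite -ltnS.
rewrite coef_deriv coefL; last by rewrite /= ltnS.
rewrite mulrC -[log_coef _ *+ _]mulr_natl; congr (_ * _).
rewrite coefD coef1 coef_pos_part; last exact: leq_trans (leq_subr _ _) _.
by rewrite subSS; case: (k - j)%N => [|i]; rewrite /= ?a0 ?mul0r ?addr0 // mul1r add0r.
Qed.

End LogarithmCoefficients.

(** * Moebius inversion *)

Section MoebiusInversion.

Lemma moebius_prime_mul p e : prime p -> (0 < e)%N -> ~~ (p %| e)%N ->
  moebius (p * e) = - moebius e.
Proof.
move=> pr_p e_gt0 npe; have p_gt0 := prime_gt0 pr_p.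
have pN : p \notin primes e by rewrite mem_primes pr_p e_gt0.
have pe : perm_eq (primes (p * e)) (p :: primes e).
  apply: uniq_perm => [||q]; rewrite ?primes_uniq //= ?primes_uniq ?pN //.
  by rewrite primesM // primes_prime // !inE.
rewrite /moebius (perm_all _ pe) (perm_size pe) /= lognM // logn_prime // eqxx.
have -> : logn p e = 0%N by apply/eqP; rewrite -leqn0 leqNgt logn_gt0.
rewrite addn0 eqxx /= (@eq_in_all _ _ (fun q => logn q e == 1)%N) => [|q qe].
  by case: ifP => _; rewrite ?oppr0 // exprS mulN1r.
rewrite lognM // logn_prime //; case: (q =P p) => // eq_qp.
by rewrite -eq_qp qe in pN.
Qed.

Lemma moebius_square p e : prime p -> (0 < e)%N -> (p ^ 2 %| e)%N -> moebius e = 0.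
Proof.
move=> pr_p e_gt0 p2e; rewrite /moebius; case: ifP => // /allP/(_ p).
rewrite pfactor_dvdn // in p2e; rewrite -logn_gt0 (ltnW p2e) => /(_ isT)/eqP lp.
by rewrite lp in p2e.
Qed.

(** For a prime p dividing [n], each divisor [e] prime to p cancels against [p * e], and multiples
    of p^2 contribute 0. *)
Lemma sum_moebius n : (0 < n)%N -> \sum_(e <- divisors n) moebius e = (n == 1)%N%:R.
Proof.
move=> n_gt0; have [->|n_ne1] := eqVneq n 1%N; first by rewrite big_seq1.
have n_gt1 : (1 < n)%N by rewrite ltn_neqAle eq_sym n_ne1.
pose p := pdiv n; have pr_p : prime p by apply: pdiv_prime.
rewrite (bigID (fun e => p %| e)%N) /=.
rewrite (bigID (fun e => p ^ 2 %| e)%N) /= big_seq_cond big1 ?add0r; last first.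
  move=> e /andP[]; rewrite -dvdn_divisors // => en /andP[_].
  by apply: moebius_square => //; apply: dvdn_gt0 en.
pose D1 := [seq e <- divisors n | ~~ (p %| e)%N].
have D2 : perm_eq [seq e <- divisors n | (p %| e)%N && ~~ (p ^ 2 %| e)%N]
                  [seq (p * e)%N | e <- D1].
  apply: uniq_perm; first by rewrite filter_uniq ?divisors_uniq.
    rewrite map_inj_uniq ?filter_uniq ?divisors_uniq // => x y /eqP.
    by rewrite eqn_pmul2l ?prime_gt0 // => /eqP.
  move=> x; rewrite mem_filter -dvdn_divisors //; apply/idP/mapP.
    case/andP=> /andP[/dvdnP[e ->]].
    rewrite mulnC expnSr expn1 dvdn_pmul2l ?prime_gt0 // => npe pen.
    exists e => //; rewrite mem_filter npe -dvdn_divisors //=.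
    exact: dvdn_trans (dvdn_mull _ _) pen.
  case=> e; rewrite mem_filter -dvdn_divisors // => /andP[npe en] ->.
  rewrite dvdn_mulr //= expnSr expn1 dvdn_pmul2l ?prime_gt0 // npe /=.
  by rewrite Gauss_dvd ?prime_coprime // pdiv_dvd en.
rewrite -big_filter (perm_big _ D2) big_map -[X in _ + X]big_filter -/D1.
rewrite -big_split big1_seq //= => e; rewrite mem_filter => /andP[npe].
rewrite -dvdn_divisors // => en; rewrite moebius_prime_mul ?addNr //.
exact: dvdn_gt0 en.
Qed.

(** A common index range for the divisors of all positive [n] up to [N] makes double divisor sums
    exchangeable. *)
Lemma big_divisors (R : nmodType) (F : nat -> R) n N : (0 < n <= N)%N ->
  \sum_(d <- divisors n) F d = \sum_(0 <= d < N.+1 | (d %| n)%N) F d.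
Proof.
case/andP=> n_gt0 lenN; rewrite -[RHS]big_filter; apply: perm_big.
apply: uniq_perm; rewrite ?divisors_uniq ?filter_uniq ?iota_uniq // => d.
rewrite mem_filter mem_index_iota -dvdn_divisors //=.
case: (boolP (d %| n)%N) => //= /(dvdn_leq n_gt0) ledn.
by rewrite ltnS (leq_trans ledn).
Qed.

Lemma moebius_inversion (R : pzRingType) (f g : nat -> R) n : (0 < n)%N ->
  (forall m, (0 < m)%N -> f m = \sum_(d <- divisors m) g d) ->
  \sum_(m <- divisors n) f m * (moebius (n %/ m))%:~R = g n.
Proof.
move=> n_gt0 fE.
have divK m : (m %| n)%N -> (n %/ (n %/ m) = m)%N.
  by move=> mn; rewrite divnA // mulKn.
have divn_perm : perm_eq (divisors n) [seq (n %/ e)%N | e <- divisors n].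
  apply: uniq_perm; first exact: divisors_uniq.
    rewrite map_inj_in_uniq ?divisors_uniq // => x y.
    by rewrite -!dvdn_divisors // => /divK{2}<- /divK{2}<- ->.
  move=> m; rewrite -dvdn_divisors //; apply/idP/mapP => [mn|[e]].
    by exists (n %/ m)%N; rewrite ?divK // -dvdn_divisors ?dvdn_div.
  by rewrite -dvdn_divisors // => en ->; apply: dvdn_div.
rewrite (perm_big _ divn_perm) big_map /=; under eq_big_seq => e.
  rewrite -dvdn_divisors // => en; have e_gt0 := dvdn_gt0 n_gt0 en.
  have ne_gt0 : (0 < n %/ e)%N by rewrite divn_gt0 // dvdn_leq.
  rewrite divK // fE // (@big_divisors _ _ _ n) ?ne_gt0 ?leq_div // mulr_suml; over.
rewrite (@big_divisors _ _ n n) ?n_gt0 ?leqnn //.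
rewrite (exchange_big_dep (fun d => d %| n)%N) /=; last first.
  by move=> e d en /dvdn_trans-> //; apply: dvdn_div.
rewrite -(@big_divisors _ _ n n) ?n_gt0 ?leqnn //.
rewrite (bigD1_seq n) ?divisors_id ?divisors_uniq //=.
(* For fixed [d] the condition on [e] says that [e] divides [n %/ d], so [sum_moebius] leaves only
   [d = n]. *)
have sumE d : (d %| n)%N ->
    \sum_(0 <= e < n.+1 | (e %| n)%N && (d %| n %/ e)%N)
      g d * (moebius e)%:~R = g d * (n == d)%:R.
  move=> dn; have d_gt0 := dvdn_gt0 n_gt0 dn.
  have nd_gt0 : (0 < n %/ d)%N by rewrite divn_gt0 // dvdn_leq.
  rewrite -mulr_sumr -rmorph_sum; congr (_ * _).
  rewrite (eq_bigl (fun e => e %| n %/ d)%N) => [|e].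
    rewrite -(@big_divisors _ moebius (n %/ d) n) ?nd_gt0 ?leq_div //.
    rewrite sum_moebius // [(_ == 1)%N]eq_sym eqn_div // mul1n eq_sym.
    by rewrite rmorph_nat.
  apply/andP/idP => [[en]|end_]; first by rewrite !dvdn_divRL // mulnC.
  have en : (e %| n)%N by apply: dvdn_trans (dvdn_div dn).
  by rewrite en dvdn_divRL // mulnC -dvdn_divRL.
rewrite sumE // eqxx mulr1 big_seq_cond big1 ?addr0 // => d /andP[].
rewrite -dvdn_divisors // => dn; rewrite eq_sym sumE // => /negPf->.
by rewrite mulr0.
Qed.

End MoebiusInversion.

(** * Comparison of the two recursions *)

(** With constant term 1, convolution by [a] can be undone: the top term of the m-th equation is
    [b m] itself, and the others agree by induction. *)
Lemma convolution_inj (R : pzRingType) (a b b' : nat -> R) : a 0 = 1 ->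
  (forall k, \sum_(1 <= m < k.+1) b m * a (k - m)%N =
             \sum_(1 <= m < k.+1) b' m * a (k - m)%N) ->
  forall m, (0 < m)%N -> b m = b' m.
Proof.
move=> a0 eq_bb' m; have [n] := ubnP m; elim: n => // n IHn in m *.
rewrite ltnS => lemn m_gt0; have := eq_bb' m.
rewrite !big_nat_recr //= subnn a0 !mulr1.
rewrite (@eq_big_nat _ _ _ _ _ _ (fun i => b' i * a (m - i)%N)) => [/addrI //|i].
by case/andP=> i_gt0 ltim; rewrite IHn // (leq_trans ltim).
Qed.

Lemma card_reps0 r : #|reps r 0| = 1%N.
Proof.
apply/eqP; rewrite eqn_leq; apply/andP; split.
  by rewrite (leq_trans (max_card _)) // card_ffun card_Sn exp1n.
rewrite card_gt0; apply/set0Pn; exists (canon 0 ([ffun=> 1%g] : psys r 'I_0)).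
by rewrite canon_reps ?card_ord.
Qed.

(** Convolved with a_k, both sides give k a_k: the left by [log_coef_rec], the right by
    [card_reps_rec]. *)
Lemma sum_trans_reps r m : (0 < r)%N -> (0 < m)%N ->
  m%:R * inner_sum r m = \sum_(d <- divisors m) d%:R * #|trans_reps r d|%:R.
Proof.
move=> r_gt0 m_gt0; pose a k : rat := #|reps r k|%:R.
have innerE k : inner_sum r k = log_coef a k.
  rewrite /inner_sum /log_coef; apply: eq_bigr => n _; congr (_ * _).
  by apply: eq_bigr => i _; rewrite /a card_reps_Zsum.
rewrite innerE; move: m m_gt0; apply: (@convolution_inj _ a).
  by rewrite /a card_reps0.
move=> k; rewrite -(@log_coef_rec a) ?/a ?card_reps0 // -natrM card_reps_rec natr_sum.
apply: eq_big_nat => m /andP[m_gt0 ltmk]; rewrite natrM; congr (_ * _).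
rewrite (@big_divisors _ _ m k) ?m_gt0 // big_mkord natr_sum.
by apply: eq_bigr => d _; rewrite natrM.
Qed.

Theorem theorem8 (r d : nat) : (1 <= r)%N -> (1 <= d)%N ->
  (num_transitive_classes r d)%:R = formula r d.
Proof.
move=> r_gt0 d_gt0; rewrite num_transitive_classesE // /formula.
have := moebius_inversion d_gt0 (fun m => sum_trans_reps (m := m) r_gt0).
under eq_bigr do rewrite mulrAC.
by move=> ->; rewrite mulKf // pnatr_eq0 -lt0n.
Qed.
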